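(* Let $n\ge 2$, let $\mathbb{P}_n$ be the real $n$-dimensional projective space with a distinguished point $A\in\mathbb{P}_n$, and let $\mathcal{R}=\{A_0,A_1,\ldots,A_n,E\}$ and $\mathcal{R}'=\{A'_0,A'_1,\ldots,A'_n,E'\}$ be two adapted projective frames (so $A_0=A'_0=A$) that are in strict perspective. Then $\mathcal{R}$ and $\mathcal{R}'$ are equivalent, $\mathcal{R}\sim\mathcal{R}'$ (that is, there is $h\in H$ with $\mathcal{R}'=h\cdot\mathcal{R}$), if and only if the Desargues hyperplane $\mathcal{L}_{(\mathcal{R},\mathcal{R}')}$ passes through $A$.
   Context: Let $V_{n+1}$ be a real vector space of dimension $n+1$, and $\mathbb{P}_n=(V_{n+1}\setminus\{0\})/{\sim}$ the quotient by collinearity, with canonical projection $\pi$. Fix a point $A\in\mathbb{P}_n$, called the center. Frames: a projective frame is an ordered set $\mathcal{R}=\{A_0,A_1,\ldots,A_n,E\}$ of $n+2$ points of $\mathbb{P}_n$ such that any $n+1$ of them are in generic position (not contained in a hyperplane). It is adapted if $A_0=A$. $F(\mathbb{P}_n)$ is the set of adapted projective frames. Groups: a projective transformation of $\mathbb{P}_n$ is a map induced by an invertible linear operator on $V_{n+1}$. $G$ is the group of projective transformations fixing $A$. It acts on $F(\mathbb{P}_n)$ by $g\cdot\mathcal{R}=\{g(A_0),g(A_1),\ldots,g(A_n),g(E)\}$. Let $V=T_A\mathbb{P}_n$ and $\beta\colon G\to GL(V)$, $\beta(g)=d_Ag$ (the differential of $g$ at $A$). Put $H=\ker\beta$. Two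 adapted frames are equivalent, $\mathcal{R}\sim\mathcal{R}'$, if they belong to the same $H$-orbit. Perspective: adapted frames $\mathcal{R}=\{A_0,\ldots,A_n,E\}$ and $\mathcal{R}'=\{A'_0,\ldots,A'_n,E'\}$ are in perspective if $A'_i$ lies on the line $A_iA_0$ for $i=1,\ldots,n$ and $E'$ lies on the line $EA_0$. They are in strict perspective if moreover $A'_i\ne A_i$ for $i=1,\ldots,n$ and $E'\neq E$. Desargues hyperplane: for frames in strict perspective, put $B_{ij}=A_iA_j\cap A'_iA'_j$ for $1\le i<j\le n$ and $B_i=A_iE\cap A'_iE'$ for $1\le i\le n$ (intersections of lines, each a single point). $\mathcal{L}_{(\mathcal{R},\mathcal{R}')}$ is the smallest (with respect to inclusion) projective subspace of $\mathbb{P}_n$ containing all the points $B_{ij}$ and $B_i$; it is a hyperplane, called the Desargues hyperplane generated by $\mathcal{R}$ and $\mathcal{R}'$. *)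

(* Defs.v *)
From HB Require Import structures.
From mathcomp Require Import all_boot all_order all_algebra.
From mathcomp Require Import all_classical all_reals all_analysis.

Set Implicit Arguments.
Unset Strict Implicit.
Unset Printing Implicit Defensive.

Import Order.TTheory GRing.Theory Num.Theory.
Import numFieldNormedType.Exports.

Local Open Scope classical_set_scope.
Local Open Scope ring_scope.
Local Open Scope quotient_scope.

Section ProjectiveSpace.
Variables (R : realType) (V : vectType R).

Definition nzvec := {x : V | x != 0}.

Definition collinear (x y : nzvec) : bool :=
  `[< exists k : R, val x = k *: val y >].

Lemma collinear_refl : reflexive collinear.
Proof. by move=> x; apply/asboolP; exists 1; rewrite scale1r. Qed.

Lemma collinear_sym : symmetric collinear.
Proof.
suff sub x y : collinear x y -> collinear y x.
  by move=> x y; apply/idP/idP; apply: sub.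
move=> /asboolP[k xky]; apply/asboolP; exists k^-1.
have [k0|k_neq0] := eqVneq k 0.
  by have := valP x; rewrite xky k0 scale0r eqxx.
by rewrite xky scalerA mulVf// scale1r.
Qed.

Lemma collinear_trans : transitive collinear.
Proof.
move=> y x z /asboolP[k xky] /asboolP[l ylz]; apply/asboolP.
by exists (k * l); rewrite xky ylz scalerA.
Qed.

Canonical collinear_equiv :=
  EquivRel collinear collinear_refl collinear_sym collinear_trans.

Definition projspace := {eq_quot collinear_equiv}.

Definition proj (x : nzvec) : projspace := \pi_projspace x.

(* The empty set, [projsub 0], counts as a projective subspace. *)
Definition projsub (U : {vspace V}) : set projspace :=
  proj @` [set x | val x \in U].

Definition projective_subspace (L : set projspace) : Prop :=
  exists U : {vspace V}, L = projsub U.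

Definition hyperplane (L : set projspace) : Prop :=
  exists2 U : {vspace V}, (\dim U).+1 = \dim {:V} & L = projsub U.

Definition projspan (S : set projspace) : set projspace :=
  smallest projective_subspace S.

Definition line (p q : projspace) : set projspace := projspan [set p; q].

Definition projective_transformation (g : projspace -> projspace) : Prop :=
  exists2 f : {linear V -> V}, bijective f &
    forall x y : nzvec, val y = f (val x) -> g (proj x) = proj y.

(* The group G of the center A. *)
Definition stabilizer (A : projspace) : set (projspace -> projspace) :=
  [set g | projective_transformation g /\ g A = A].

Section Differential.
Variable n : nat.

(* Homogeneous coordinates (x_0 : ... : x_n) on P(V), given by a basis of V. *)
Definition chart := {b : n.+1.-tuple V | basis_of fullv b}.

(* The affine chart x_0 <> 0, with coordinates (x_1/x_0, ..., x_n/x_0). *)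
Definition chart_dom (c : chart) : set projspace :=
  [set p | coord (val c) ord0 (val (repr p)) != 0].

Definition chart_map (c : chart) (p : projspace) : 'rV[R]_n :=
  \row_(i < n) (coord (val c) (lift ord0 i) (val (repr p))
                / coord (val c) ord0 (val (repr p))).

Definition chart_vec (c : chart) (v : 'rV[R]_n) : V :=
  tnth (val c) ord0 + \sum_(i < n) v ord0 i *: tnth (val c) (lift ord0 i).

Lemma chart_vec_neq0 (c : chart) (v : 'rV[R]_n) : chart_vec c v != 0.
Proof.
have /freeP fc := basis_free (valP c).
apply/eqP => c0.
pose k i := if unlift ord0 i is Some j then v ord0 j else 1.
have /fc/(_ ord0) : \sum_(i < n.+1) k i *: (val c)`_i = 0.
  rewrite -[RHS]c0 /chart_vec big_ord_recl /k unlift_none scale1r (tnth_nth 0).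
  by congr +%R; apply: eq_bigr => i _; rewrite liftK (tnth_nth 0).
by rewrite /k unlift_none => /eqP; rewrite oner_eq0.
Qed.

Definition chart_inv (c : chart) (v : 'rV[R]_n) : projspace :=
  proj (exist _ (chart_vec c v) (chart_vec_neq0 c v)).

(* The differential d_A g, for g fixing A, read in the chart c around A, i.e.
   under the identification of T_A P(V) with R^n given by c. *)
Definition differential (c : chart) (A : projspace)
    (g : projspace -> projspace) : 'rV[R]_n -> 'rV[R]_n :=
  'd (chart_map c \o g \o chart_inv c) (chart_map c A).

(* The kernel H of g |-> d_A g on G: d_A g is the identity of T_A P(V). As this
   does not depend on the chart, it is required in all the charts around A. *)
Definition kernel_differential (A : projspace) :
    set (projspace -> projspace) :=
  [set g | stabilizer A g /\
    forall c : chart, chart_dom c A -> differential c A g = id].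

(* {A_0, ..., A_n, E} is encoded as the family of its n+2 points, E coming
   last. *)
Definition vertex (F : 'I_n.+2 -> projspace) (i : 'I_n.+1) : projspace :=
  F (widen_ord (leqnSn n.+1) i).

Definition unit_point (F : 'I_n.+2 -> projspace) : projspace := F ord_max.

(* Omitting the point of index k leaves n+1 points in generic position. *)
Definition projective_frame (F : 'I_n.+2 -> projspace) : Prop :=
  forall k : 'I_n.+2,
    ~ exists2 L, hyperplane L & forall j, j != k -> L (F j).

Definition adapted_frame (A : projspace) (F : 'I_n.+2 -> projspace) : Prop :=
  projective_frame F /\ vertex F ord0 = A.

Definition frame_equiv (A : projspace) (F F' : 'I_n.+2 -> projspace) : Prop :=
  exists2 h, kernel_differential A h & F' = h \o F.

Definition in_perspective (F F' : 'I_n.+2 -> projspace) : Prop :=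
  (forall i, i != ord0 -> line (vertex F i) (vertex F ord0) (vertex F' i)) /\
  line (unit_point F) (vertex F ord0) (unit_point F').

Definition in_strict_perspective (F F' : 'I_n.+2 -> projspace) : Prop :=
  [/\ in_perspective F F',
      forall i, i != ord0 -> vertex F' i <> vertex F i
    & unit_point F' <> unit_point F].

(* The points B_ij and B_i; for adapted frames in strict perspective each of
   the intersections below is a single point. *)
Definition desargues_points (F F' : 'I_n.+2 -> projspace) : set projspace :=
  [set B | exists i j : 'I_n.+1, (0 < i < j)%N /\
    (line (vertex F i) (vertex F j) `&` line (vertex F' i) (vertex F' j)) B] `|`
  [set B | exists i : 'I_n.+1, (0 < i)%N /\
    (line (vertex F i) (unit_point F) `&`
     line (vertex F' i) (unit_point F')) B].

Definition desargues_hyperplane (F F' : 'I_n.+2 -> projspace) :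
    set projspace :=
  projspan (desargues_points F F').

End Differential.
End ProjectiveSpace.

(* Main.v *)
Require Import Defs.
From HB Require Import structures.
From mathcomp Require Import all_boot all_order all_algebra.
From mathcomp Require Import all_classical all_reals all_analysis.
From mathcomp Require Import ring.
Import Defs.

Set Implicit Arguments.
Unset Strict Implicit.
Unset Printing Implicit Defensive.

Import Order.TTheory GRing.Theory Num.Theory.
Import numFieldNormedType.Exports.

Local Open Scope classical_set_scope.
Local Open Scope ring_scope.

(** Normalize vectors: since the n+2 vectors of the points of a frame satisfy a
    single linear relation, all of whose coefficients are nonzero, the vectors
    e_0, ..., e_n of A_1, ..., A_n, E can be scaled so that their sum a is a
    vector of A_0 = A; they form a basis ([frame_chart]). Thus A is the unit
    point of the frame whose vertices are the other points, and A_1, ..., A_n, E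
    play symmetric roles.

    A frame in strict perspective consists of A and of points with vectors
    e_i + t_i a, all t_i being nonzero. Let phi be the linear form with
    phi(e_i) = t_i. These vectors are the images of the e_i under the central
    collineation x |-> x + phi(x) a, with center A and axis ker phi
    ([strict_perspective_collin]). Both sides of the equivalence mean that
    phi(a) = 0, that is, that this collineation is an elation:

    - The line through two of the points A_1, ..., A_n, E and the line through
      their images meet at the point of t_j e_i - t_i e_j. These vectors span ker phi, so the Desargues
      hyperplane is the axis, and it contains A if and only if phi(a) = 0
      ([desargues_hyperplane_axis]).

    - A projective transformation is determined by its values on a frame, so the
      only one that maps F to F' is this collineation. In an affine chart it is
      v |-> p + s(v)^-1 (v - p), where p is the center and s is affine with
      s(p) = 1 + phi(a); hence its differential at A is the homothety of ratio
      (1 + phi(a))^-1 ([differential_collin]). It is the identity if and only if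
      phi(a) = 0 ([frame_equiv_elation]). *)

(** * Homogeneous vectors of points *)

Section HomogeneousVectors.
Variables (R : realType) (V : vectType R).
Implicit Types (p q r : projspace V) (x y z : V) (U W : {vspace V}).

Definition homvec p x : Prop := exists2 u : nzvec V, proj u = p & val u = x.

Lemma homvec_neq0 p x : homvec p x -> x != 0.
Proof. by case=> u _ <-; exact: (valP u). Qed.

Lemma homvec_repr p : homvec p (val (repr p)).
Proof. by exists (repr p) => //; rewrite /proj; exact: reprK. Qed.

Lemma homvec_exists x : x != 0 -> exists p, homvec p x.
Proof. by move=> x0; exists (proj (exist _ x x0)); exists (exist _ x x0). Qed.

Lemma homvec_scale p x (k : R) : k != 0 -> homvec p x -> homvec p (k *: x).
Proof.
move=> k0 [u <- <-].
have ku0 : k *: val u != 0 by rewrite scaler_eq0 negb_or k0 (valP u).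
exists (exist _ (k *: val u) ku0) => //; apply/eqquotP/asboolP; by exists k.
Qed.

Lemma homvec_inj p x y :
  homvec p x -> homvec p y -> exists2 k : R, k != 0 & y = k *: x.
Proof.
move=> px py; move: (px) (py) (homvec_neq0 py) => [u pu <-] [w pw <-] w0.
have /eqquotP/asboolP[k wku] : proj w = proj u :> projspace V by rewrite pu pw.
exists k => //; apply: contraNneq w0 => k0; by rewrite wku k0 scale0r.
Qed.

Lemma homvec_point_inj p q x : homvec p x -> homvec q x -> p = q.
Proof. by move=> [u <- <-] [w <- /val_inj ->]. Qed.

Lemma projsubE U p x : homvec p x -> projsub U p <-> x \in U.
Proof.
move=> px; split=> [[u /= uU up]|xU].
  by have [k _ ->] := homvec_inj (ex_intro2 _ _ u up erefl) px; exact: memvZ.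
by move: px xU => [u <- <-] uU; exists u.
Qed.

Lemma projspanP (S : set (projspace V)) p :
  projspan S p <-> forall U, S `<=` projsub U -> projsub U p.
Proof.
split=> [Sp U SU|Sp _ [[U ->] SU]]; last exact: Sp.
by apply: Sp; split=> //; exists U.
Qed.

Lemma lineP p q r x y z : homvec p x -> homvec q y -> homvec r z ->
  line p q r <-> exists k l : R, z = k *: x + l *: y.
Proof.
move=> px qy rz; split=> [/projspanP pqr|[k [l zxy]]].
  have /pqr/(projsubE _ rz)/memv_addP : [set p; q] `<=` projsub (<[x]> + <[y]>).
    move=> _ [->|->]; [apply/(projsubE _ px)|apply/(projsubE _ qy)].
      exact/(subvP (addvSl _ _))/memv_line.
    exact/(subvP (addvSr _ _))/memv_line.
  by move=> [_ /vlineP[k ->] [_ /vlineP[l ->] ->]]; exists k, l.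
apply/projspanP => U pqU; apply/(projsubE _ rz); rewrite zxy.
by apply: memvD; apply: memvZ;
  [apply/(projsubE _ px)|apply/(projsubE _ qy)]; apply: pqU; [left|right].
Qed.

(** Used to enlarge a subspace that is too small to a hyperplane, which turns
    the generic position of a frame into linear independence. *)
Lemma subv_dim_extend U (m : nat) : (\dim U <= m <= \dim {:V})%N ->
  exists2 W, (U <= W)%VS & \dim W = m.
Proof.
move=> /andP[Um mV]; pose X := take (m - \dim U) (vbasis U^C).
have XC : (<<X>> <= U^C)%VS.
  rewrite -[X in (_ <= X)%VS](span_basis (vbasisP U^C)); apply: sub_span => x.
  exact: mem_take.
have dX : \dim <<X>> = (m - \dim U)%N.
  rewrite (eqP (_ : free X)).
    by rewrite size_takel // size_tuple dimv_compl leq_sub2r.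
  apply: (@catl_free _ _ (drop (m - \dim U) (vbasis U^C))).
  by rewrite cat_take_drop; exact: basis_free (vbasisP _).
exists (U + <<X>>)%VS; first exact: addvSl.
rewrite dimv_disjoint_sum; first by rewrite dX subnKC.
by apply/eqP; rewrite -subv0 -(capv_compl U) capvS.
Qed.

End HomogeneousVectors.

(** * Frames and bases *)

Section Frames.
Variables (R : realType) (n : nat) (V : vectType R).
Hypothesis dimV : \dim {: V} = n.+1.
Implicit Types (F : 'I_n.+2 -> projspace V) (e : chart V n).

Lemma chart_coord e (k : 'I_n.+1 -> R) i :
  coord (val e) i (\sum_j k j *: tnth (val e) j) = k i.
Proof.
rewrite -[RHS](coord_sum_free _ _ (basis_free (valP e))).
by congr coord; apply: eq_bigr => j _; rewrite (tnth_nth 0).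
Qed.

(** In the bases of [frame_chart], the sum of the basis is a vector of the
    center. *)
Lemma coord_center e i : coord (val e) i (\sum_j tnth (val e) j) = 1.
Proof.
rewrite -[RHS](chart_coord e (fun=> 1) i).
by congr coord; apply: eq_bigr => j _; rewrite scale1r.
Qed.

Lemma chart_sum e x : x = \sum_j coord (val e) j x *: tnth (val e) j.
Proof.
rewrite [LHS](coord_basis (valP e) (memvf x)).
by apply: eq_bigr => j _; rewrite (tnth_nth 0).
Qed.

Lemma chart_coordE e i j :
  coord (val e) i (tnth (val e) j) = (j == i)%:R.
Proof. by rewrite (tnth_nth 0) coord_free // (basis_free (valP e)). Qed.

Lemma form_of_chart e (t : 'I_n.+1 -> R) :
  exists phi : {scalar V}, forall i, phi (tnth (val e) i) = t i.
Proof.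
pose f x := \sum_i t i * coord (val e) i x.
have f_scalar : scalar f.
  move=> k x y; rewrite /f mulr_sumr -big_split; apply: eq_bigr => i _.
  by rewrite /= linearP /= mulrDr mulrCA.
pose fL := GRing.isLinear.Build R V R *%R f f_scalar.
pose phi : {scalar V} := HB.pack f fL.
exists phi => i; rewrite /= /f (bigD1 i) //= chart_coordE eqxx mulr1.
rewrite big1 ?addr0 // => j /negPf ji.
by rewrite chart_coordE eq_sym ji mulr0.
Qed.

(** Gives the axis of a central collineation as a vector subspace, hence as a
    projective subspace. *)
Lemma scalar_kernel (phi : {scalar V}) :
  exists U : {vspace V}, forall x, x \in U <-> phi x = 0.
Proof.
have f_linear : linear (phi : V -> R^o) by move=> k x y; rewrite linearP.
pose fL := GRing.isLinear.Build R V R^o *:%R (phi : V -> R^o) f_linear.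
pose f : {linear V -> R^o} := HB.pack (phi : V -> R^o) fL.
exists (lker (linfun f)) => x; rewrite memv_ker lfunE.
by split=> [/eqP|/eqP].
Qed.

Lemma sum_ord_lift (M : nmodType) (k : 'I_n.+2) (G : 'I_n.+2 -> M) :
  \sum_j G j = G k + \sum_i G (lift k i).
Proof. by rewrite (bigD1_ord k). Qed.

(** If some n+1 of the points had dependent vectors, these would lie in a
    hyperplane. So a linear relation with one zero coefficient is trivial: the
    relation between the n+2 vectors involves all of them. *)
Lemma frame_relation F (r : 'I_n.+2 -> V) (m : 'I_n.+2 -> R) k :
  projective_frame F -> (forall j, homvec (F j) (r j)) ->
  \sum_j m j *: r j = 0 -> m k = 0 -> forall j, m j = 0.
Proof.
move=> frF Fr mr0 mk0.
pose X := [tuple r (lift k i) | i < n.+1].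
have freeX : free X.
  rewrite /free size_tuple eqn_leq (leq_trans (dim_span X)) ?size_tuple //=.
  rewrite leqNgt; apply/negP => dX; apply: (frF k).
  have [|W XW dW] := @subv_dim_extend _ _ <<X>>%VS n.
    by rewrite -ltnS dX dimV leqnSn.
  exists (projsub W); first by exists W; rewrite ?dW ?dimV.
  move=> j; rewrite eq_sym => jk.
  apply/(projsubE _ (Fr j))/(subvP XW)/memv_span.
  have [i -> _] := unlift_some jk.
  by apply/tnthP; exists i; rewrite tnth_mktuple.
move=> j; have [->//|] := eqVneq j k; rewrite eq_sym => jk.
have [i -> _] := unlift_some jk.
move/freeP: freeX => /(_ (fun i => m (lift k i)) _ i); apply.
rewrite -[RHS]mr0 (sum_ord_lift k) mk0 scale0r add0r.
by apply: eq_bigr => {}i _; rewrite -tnth_nth tnth_mktuple.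
Qed.

(** The usual normalization of a frame, with the center in the role of the unit
    point: the coefficients of its vector on the n+1 other vectors are nonzero
    by [frame_relation], and are absorbed by rescaling these vectors. *)
Lemma frame_chart F : projective_frame F -> exists e : chart V n,
  (forall i, homvec (F (lift ord0 i)) (tnth (val e) i)) /\
  homvec (F ord0) (\sum_i tnth (val e) i).
Proof.
move=> frF; pose r j := val (repr (F j)).
have Fr j : homvec (F j) (r j) by exact: homvec_repr.
have basisP (c : 'I_n.+1 -> R) : (forall i, c i != 0) ->
    basis_of {:V} [tuple c i *: r (lift ord0 i) | i < n.+1].
  move=> c0; rewrite basisEfree subvf size_tuple dimV leqnn !andbT.
  apply/freeP => k kr0 i.
  pose m j := if unlift ord0 j is Some i then k i * c i else 0.
  have m0 : \sum_j m j *: r j = 0.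
    rewrite (sum_ord_lift ord0) {1}/m unlift_none scale0r add0r -[RHS]kr0.
    by apply: eq_bigr => j _; rewrite /m liftK -tnth_nth tnth_mktuple scalerA.
  have := frame_relation (k := ord0) frF Fr m0.
  rewrite /m unlift_none => /(_ erefl (lift ord0 i)).
  by rewrite liftK => /eqP; rewrite mulf_eq0 (negPf (c0 i)) orbF => /eqP.
pose rescaled c c0 : chart V n :=
  exist (fun b : n.+1.-tuple V => basis_of {:V} b) _ (basisP c c0).
pose X := rescaled (fun=> 1) (fun=> oner_neq0 R).
pose c i := coord (val X) i (r ord0).
have r0E : r ord0 = \sum_i c i *: r (lift ord0 i).
  rewrite [LHS](chart_sum X); apply: eq_bigr => i _.
  by rewrite tnth_mktuple scale1r.
have c0 i : c i != 0.
  apply/negP => /eqP ci0.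
  pose m j := if unlift ord0 j is Some i then c i else -1.
  have m0 : \sum_j m j *: r j = 0.
    rewrite (sum_ord_lift ord0) {1}/m unlift_none scaleN1r r0E.
    apply/eqP; rewrite addrC subr_eq0; apply/eqP; apply: eq_bigr => j _.
    by rewrite /m liftK.
  have := frame_relation (k := lift ord0 i) frF Fr m0.
  rewrite {1}/m liftK => /(_ ci0 ord0).
  by rewrite /m unlift_none => /eqP; rewrite oppr_eq0 oner_eq0.
exists (rescaled c c0); split => [i|] /=.
  by rewrite tnth_mktuple; exact: homvec_scale.
under eq_bigr do rewrite tnth_mktuple.
by rewrite -r0E.
Qed.

End Frames.

(** * Central collineations *)

Section CentralCollineations.
Variables (R : realType) (V : vectType R).
Implicit Types (phi : {scalar V}) (a x : V).

(** When phi(a) <> -1, the central collineation with center the point of a and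
    axis the kernel of phi. *)
Definition collin phi a x : V := x + phi x *: a.

Lemma collin_is_linear phi a : linear (collin phi a).
Proof.
move=> k x y; rewrite /collin linearP /= scalerDl scalerDr addrACA.
by rewrite -scalerA.
Qed.

HB.instance Definition _ phi a :=
  GRing.isLinear.Build R V V *:%R (collin phi a) (@collin_is_linear phi a).

Lemma form_collin phi a x (psi : {scalar V}) :
  psi (collin phi a x) = psi x + phi x * psi a.
Proof. by rewrite /collin linearD linearZ. Qed.

Lemma collin_center phi a : collin phi a a = (1 + phi a) *: a.
Proof. by rewrite /collin scalerDl scale1r. Qed.

(** Composing x + phi(x) b with x + phi(x) c adds the vectors b and c when
    phi(b) = 0, so that -a gives the inverse. *)
Lemma elation_bij phi a : phi a = 0 -> bijective (collin phi a).
Proof.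
move=> a0.
have centralK b c x : phi b = 0 ->
    collin phi c (collin phi b x) = x + phi x *: (b + c).
  move=> b0; rewrite /collin [phi (_ + _)]linearD linearZ /= b0.
  by rewrite mulr0 addr0 scalerDr addrA.
have Na0 : phi (- a) = 0 by rewrite raddfN /= a0 oppr0.
exists (collin phi (- a)) => x.
  by rewrite centralK // subrr scaler0 addr0.
by rewrite centralK // addNr scaler0 addr0.
Qed.

Lemma linear_inj_neq0 (f : {linear V -> V}) x :
  injective f -> x != 0 -> f x != 0.
Proof.
by move=> finj; apply: contra_neq => fx0; apply: finj; rewrite linear0.
Qed.

Lemma projective_transformation_homvec (g : projspace V -> projspace V)
    (f : {linear V -> V}) p x :
  bijective f ->
  (forall u w : nzvec V, val w = f (val u) -> g (proj u) = proj w) ->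
  homvec p x -> homvec (g p) (f x).
Proof.
move=> /bij_inj finj gf [u <- <-].
have fu0 := linear_inj_neq0 finj (valP u).
by exists (exist _ (f (val u)) fu0) => //; exact/esym/gf.
Qed.

Lemma projective_transformation_exists (f : {linear V -> V}) :
  bijective f -> exists2 g, projective_transformation g &
    forall p x, homvec p x -> homvec (g p) (f x).
Proof.
move=> fbij.
have f0 (u : nzvec V) : f (val u) != 0.
  exact: linear_inj_neq0 (bij_inj fbij) (valP u).
pose fnz (u : nzvec V) : nzvec V := exist _ (f (val u)) (f0 u).
pose g (p : projspace V) : projspace V := proj (fnz (repr p)).
have gf p x : homvec p x -> homvec (g p) (f x).
  move=> px; have [k k0 ->] := homvec_inj (homvec_repr p) px.
  by rewrite linearZ; apply: homvec_scale => //; exists (fnz (repr p)).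
exists g => //; exists f => // u w wE.
apply: (@homvec_point_inj _ _ _ _ (val w)); last by exists w.
by rewrite wE; apply: gf; exists u.
Qed.

End CentralCollineations.

(** * The differential of a central collineation at its center *)

Section DifferentialAtCenter.
Variables (R : realType).

(** A map that rescales the vectors from p by a varying ratio s is, to the first
    order, the homothety of center p and ratio s(p): the error at p + u is
    (s(p + u) - s(p)) u, and s is continuous at p. *)
Lemma diff_radial (E : normedModType R) (G : E -> E) (s : E -> R) (p : E) :
  (\forall v \near p, G v = p + s v *: (v - p)) -> {for p, continuous s} ->
  'd G p = (fun u => s p *: u) :> (E -> E).
Proof.
move=> Gs cs; have Gp : G p = p.
  by rewrite (nbhs_singleton Gs) subrr scaler0 addr0.
apply: (@diff_unique R E E G (s p \*: (idfun : {linear E -> E}))).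
  by move=> u; apply: (@scaler_continuous R E (s p)).
apply/eqaddoP => _/posnumP[eps].
have /cvgrPdist_le/(_ eps%:num (ltac:(by [])))/= := cs.
move/(filterI Gs) => {}Gs.
have : u + p @[u --> (0 : E)] --> p.
  by rewrite -[X in _ --> X]add0r; apply: cvgD; [exact: cvg_id|exact: cvg_cst].
move=> /(_ _ Gs) Gs0.
near=> u.
have [] : G (u + p) = p + s (u + p) *: (u + p - p) /\
    `|s p - s (u + p)| <= eps%:num 
    by near: u; exact: Gs0.
rewrite addrK => GE sE'.
rewrite !fctE /= GE Gp opprD addrACA subrr add0r -scalerBl normrZ distrC.
exact: ler_wpM2r.
Unshelve. all: by end_near. Qed.

Variables (n : nat) (V : vectType R).

Lemma chart_map_homvec (c : chart V n) p x : homvec p x ->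
  chart_map c p = \row_i (coord (val c) (lift ord0 i) x / coord (val c) ord0 x).
Proof.
move=> px; have [k k0 ->] := homvec_inj (homvec_repr p) px.
by apply/rowP => i; rewrite !mxE !linearZ /= -mulf_div divff // mul1r.
Qed.

Lemma chart_dom_homvec (c : chart V n) p x : homvec p x ->
  chart_dom c p <-> coord (val c) ord0 x != 0.
Proof.
move=> px; have [k k0 ->] := homvec_inj (homvec_repr p) px.
by rewrite /chart_dom /= linearZ /= mulf_eq0 negb_or k0.
Qed.

Lemma coord_chart_vec (c : chart V n) (v : 'rV_n) i :
  coord (val c) i (chart_vec c v) =
  if unlift ord0 i is Some j then v ord0 j else 1.
Proof.
rewrite -[RHS](chart_coord c (fun i => if unlift ord0 i is Some j then v ord0 j
  else 1)) big_ord_recl unlift_none scale1r.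
by congr (coord _ _ (_ + _)); apply: eq_bigr => j _; rewrite liftK.
Qed.

Lemma homvec_chart_inv (c : chart V n) (v : 'rV_n) :
  homvec (chart_inv c v) (chart_vec c v).
Proof. by exists (exist _ (chart_vec c v) (chart_vec_neq0 c v)). Qed.

Lemma continuous_chart_form (c : chart V n) (phi : {scalar V}) :
  continuous (fun v : 'rV[R]_n => phi (chart_vec c v)).
Proof.
move=> v; rewrite (_ : (fun _ => _) =
  (fun v : 'rV[R]_n => phi (tnth (val c) ord0) +
   \sum_i v ord0 i * phi (tnth (val c) (lift ord0 i)))).
  apply: (@cvgD _ _ _ (nbhs v)); first exact: cvg_cst.
  apply: (@cvg_big _ _ _ _ _ _ _ (nbhs v)) => [|i _].
    exact: add_continuous.
  by apply: (@cvgM _ _ (nbhs v)); [exact: coord_continuous|exact: cvg_cst].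
apply/funext => w; rewrite linearD linear_sum /=; congr (_ + _).
by apply: eq_bigr => i _; rewrite linearZ.
Qed.

(** Write a_0 for the leading coordinate of a. In the chart, the collineation
    is p + s(v)^-1 (v - p) with s(v) = 1 + a_0 phi(x), where x is the vector
    with coordinates (1, v); at the center x = a / a_0, so that s(p) = 1 + phi(a). *)
Lemma differential_collin (c : chart V n) A a (phi : {scalar V}) g :
  homvec A a -> chart_dom c A -> 1 + phi a != 0 ->
  (forall p x, homvec p x -> homvec (g p) (collin phi a x)) ->
  differential c A g = (fun v => (1 + phi a)^-1 *: v).
Proof.
move=> Aa /(chart_dom_homvec c Aa) a0 phia gE.
set a0' := coord _ _ _ in a0.
pose s v : R := 1 + phi (chart_vec c v) * a0'.
set p := chart_map c A.
have sp : s p = 1 + phi a.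
  suff aE : a = a0' *: chart_vec c p by rewrite /s [in RHS]aE linearZ mulrC.
  rewrite [LHS](chart_sum c) big_ord_recl scalerDr; congr (_ + _).
  rewrite scaler_sumr; apply: eq_bigr => i _.
  by rewrite scalerA /p (chart_map_homvec c Aa) mxE mulrCA divff // mulr1.
have cs : {for p, continuous s}.
  apply: (@cvgD _ _ _ (nbhs p)); first exact: cvg_cst.
  by apply: cvgM; [exact: continuous_chart_form|exact: cvg_cst].
have csV : {for p, continuous (fun v => (s v)^-1)}.
  by apply: (@cvgV _ _ (nbhs p)); [rewrite sp|exact: cs].
rewrite /differential -sp; apply: diff_radial csV.
have sn0 : \forall v \near p, s v != 0.
  by apply: (cvgr_neq0 (s p) cs); rewrite sp.
near=> v.
have sv0 : s v != 0 by near: v; exact: sn0.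
have Gv : homvec (g (chart_inv c v)) (collin phi a (chart_vec c v)).
  exact/gE/homvec_chart_inv.
rewrite /= (chart_map_homvec c Gv) /p (chart_map_homvec c Aa); apply/rowP => i.
rewrite !mxE !form_collin /= !coord_chart_vec liftK unlift_none.
rewrite -/a0'; move: sv0; rewrite /s => sv0; field.
by rewrite sv0 a0.
Unshelve. all: by end_near. Qed.

End DifferentialAtCenter.

(** * Frames in strict perspective *)

Section StrictPerspective.
Variables (R : realType) (n : nat) (V : vectType R).
Implicit Types (F : 'I_n.+2 -> projspace V) (e : chart V n).

(** Treats the vertices A_1, ..., A_n and the unit point uniformly, as the
    points of index lift ord0 i. *)
Lemma nonzero_indexP (P : 'I_n.+2 -> Prop) :
  (forall i : 'I_n.+1, i != ord0 -> P (widen_ord (leqnSn n.+1) i)) ->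
  P ord_max -> forall i : 'I_n.+1, P (lift ord0 i).
Proof.
move=> Pw Pm i; have [im|im] := eqVneq i ord_max.
  by rewrite im (_ : lift _ _ = ord_max) //; apply: val_inj.
have ltin : (i.+1 < n.+1)%N.
  by rewrite ltnS ltn_neqAle -ltnS ltn_ord andbT.
rewrite (_ : lift _ _ = widen_ord (leqnSn n.+1) (Ordinal ltin)) //.
  exact: Pw.
exact: val_inj.
Qed.

Lemma desargues_pointsP F F' B : desargues_points F F' B <->
  exists i j : 'I_n.+1, (i < j)%N /\
    (line (F (lift ord0 i)) (F (lift ord0 j)) `&`
     line (F' (lift ord0 i)) (F' (lift ord0 j))) B.
Proof.
have lift0E (i : 'I_n.+1) (i0 : (0 < i)%N) : exists2 k : 'I_n.+1,
    widen_ord (leqnSn n.+1) i = lift ord0 k & i = k.+1 :> nat.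
  have ltin : (i.-1 < n.+1)%N by exact: leq_ltn_trans (leq_pred _) (ltn_ord i).
  exists (Ordinal ltin); last by rewrite prednK.
  by apply: val_inj; rewrite /= /bump leq0n add1n prednK.
have maxE : ord_max = lift ord0 ord_max :> 'I_n.+2 by exact: val_inj.
split=> [[[i [j [/andP[i0 ij]]]]|[i [i0]]]|[i [j []]]].
- have [k kE ik] := lift0E i i0; have [l lE jl] := lift0E j (ltn_trans i0 ij).
  rewrite /vertex kE lE => Bij; exists k, l; split=> //.
  by rewrite ik jl in ij.
- have [k kE ik] := lift0E i i0.
  rewrite /vertex /unit_point kE maxE => Bi; exists k, ord_max; split=> //.
  by rewrite /= -ltnS -ik.
- have [->|jm] := eqVneq j ord_max.
    move=> im; rewrite -maxE; have ltin : (i.+1 < n.+1)%N by rewrite ltnS.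
    have wE : lift ord0 i = widen_ord (leqnSn n.+1) (Ordinal ltin).
      exact: val_inj.
    by rewrite wE => Bi; right; exists (Ordinal ltin).
  have ltjn : (j.+1 < n.+1)%N.
    by rewrite ltnS ltn_neqAle -ltnS ltn_ord andbT.
  move=> ij; have ltin : (i.+1 < n.+1)%N by exact: ltn_trans _ ltjn.
  have wE (k : 'I_n.+1) (ltkn : (k.+1 < n.+1)%N) :
      lift ord0 k = widen_ord (leqnSn n.+1) (Ordinal ltkn) by exact: val_inj.
  rewrite (wE i ltin) (wE j ltjn) => Bij.
  by left; exists (Ordinal ltin), (Ordinal ltjn).
Qed.

Lemma exists_third (i j : 'I_n.+1) : (2 <= n)%N ->
  exists k, k != i /\ k != j.
Proof.
move=> n2; suff /existsP[k /andP[ki kj]] : [exists k, (k != i) && (k != j)].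
  by exists k.
apply: contraLR (n2) => /existsPn ij.
rewrite -ltnNge -ltnS -[n.+1]size_enum_ord -[X in (_ < X.+1)%N]/(size [:: i; j]).
apply: uniq_leq_size (enum_uniq _) _ => k _; move: (ij k).
by rewrite !inE negb_and !negbK.
Qed.

Hypothesis dimV : \dim {: V} = n.+1.

Lemma frame_center_neq F i : (2 <= n)%N -> projective_frame F ->
  F (lift ord0 i) <> F ord0.
Proof.
move=> n2 frF; have [e [Fe F0]] := frame_chart dimV frF => FiE.
have := Fe i; rewrite FiE => /homvec_inj/(_ F0)[k _ aE].
have [j [ji _]] := exists_third i i n2.
have := coord_center e j.
rewrite aE linearZ /= chart_coordE eq_sym (negPf ji) mulr0.
by move/esym/eqP; rewrite oner_eq0.
Qed.

Lemma frame_center A F : adapted_frame A F -> F ord0 = A.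
Proof. by move=> [_ <-]; congr F; exact: val_inj. Qed.

(** The coefficient of e_i in a vector of the i-th point of F' is nonzero
    because that point is not A; dividing by it gives e_i + t_i a. Strictness says that
    t_i <> 0. Finally 1 + phi(a) is the coefficient of a in the linear relation
    between the vectors of F', hence it is nonzero. *)
Lemma strict_perspective_collin A F F' : (2 <= n)%N ->
  adapted_frame A F -> adapted_frame A F' -> in_strict_perspective F F' ->
  exists e (phi : {scalar V}), let a := \sum_i tnth (val e) i in
  [/\ homvec A a,
      forall i, homvec (F (lift ord0 i)) (tnth (val e) i),
      forall i, homvec (F' (lift ord0 i)) (collin phi a (tnth (val e) i)),
      forall i, phi (tnth (val e) i) != 0
    & 1 + phi a != 0].
Proof.
have w0 : widen_ord (leqnSn n.+1) ord0 = ord0 by exact: val_inj.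
move=> n2 adF adF'; have [[frF _] [frF' _]] := (adF, adF').
have [F0 F'0] := (frame_center adF, frame_center adF').
case=> [[]]; rewrite /vertex /unit_point w0 F0 => lV lE neqV neqE.
have [e [Fe]] := frame_chart dimV frF; rewrite F0.
set a := \sum_i _ => Aa.
have persp i : line (F (lift ord0 i)) A (F' (lift ord0 i)).
  exact: (@nonzero_indexP (fun j => line (F j) A (F' j))).
have neq i : F' (lift ord0 i) <> F (lift ord0 i).
  exact: (@nonzero_indexP (fun j => F' j <> F j)).
have /choice[t tP] i : exists t : R,
    t != 0 /\ homvec (F' (lift ord0 i)) (tnth (val e) i + t *: a).
  have F'i := homvec_repr (F' (lift ord0 i)).
  have /(lineP (Fe i) Aa F'i)[k [l rE]] := persp i.
  have k0 : k != 0.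
    apply/eqP => k0; apply: (frame_center_neq (i := i) n2 frF').
    rewrite F'0; have l0 : l != 0.
      apply: contra_neq (homvec_neq0 F'i) => l0.
      by rewrite rE k0 l0 !scale0r addr0.
    apply: homvec_point_inj F'i _; rewrite rE k0 scale0r add0r.
    exact: homvec_scale.
  exists (k^-1 * l); split.
    rewrite mulf_neq0 ?invr_neq0 //; apply/eqP => l0; apply: (neq i).
    apply: homvec_point_inj F'i _; rewrite rE l0 scale0r addr0.
    exact: homvec_scale.
  rewrite -scalerA -[tnth _ _](scalerK k0) -scalerDr -rE.
  by apply: homvec_scale F'i; rewrite invr_neq0.
have [phi phiE] := form_of_chart e t.
have F'e i : homvec (F' (lift ord0 i)) (collin phi a (tnth (val e) i)).
  by rewrite /collin phiE; case: (tP i).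
exists e, phi; split=> // [i|]; first by rewrite phiE; case: (tP i).
apply/eqP => phia.
(* With phi(a) = -1, the vectors of the points of F' other than A sum to 0. *)
pose r j := if unlift ord0 j is Some i then collin phi a (tnth (val e) i)
            else a.
have F'r j : homvec (F' j) (r j).
  rewrite /r; case: unliftP => [i ->|->]; first exact: F'e.
  by rewrite F'0.
pose m (j : 'I_n.+2) : R := if unlift ord0 j is Some i then 1 else 0.
have mr0 : \sum_j m j *: r j = 0.
  rewrite (sum_ord_lift ord0) {1}/m unlift_none scale0r add0r.
  under eq_bigr do rewrite /m /r liftK scale1r.
  by rewrite -linear_sum /= collin_center phia scale0r.
have := frame_relation dimV (k := ord0) frF' F'r mr0.
rewrite /m unlift_none => /(_ erefl (lift ord0 ord0)).
by rewrite liftK => /eqP; rewrite oner_eq0.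
Qed.

(** Let a vector of a Desargues point be x e_i + y e_j and also
    x' (e_i + t_i a) + y' (e_j + t_j a). As n >= 2, there is a third basis
    vector; its coefficient in both expressions gives x' t_i + y' t_j = 0, and
    then x = x' and y = y', so that the vector is in the kernel of phi.
    Conversely, the vectors t_j e_0 - t_0 e_j already generate a when
    phi(a) = 0, since their sum is phi(a) e_0 - t_0 a. *)
Lemma desargues_hyperplane_axis A F F' e (phi : {scalar V})
    (a := \sum_i tnth (val e) i) : (2 <= n)%N -> homvec A a ->
  (forall i, homvec (F (lift ord0 i)) (tnth (val e) i)) ->
  (forall i, homvec (F' (lift ord0 i)) (collin phi a (tnth (val e) i))) ->
  (forall i, phi (tnth (val e) i) != 0) ->
  desargues_hyperplane F F' A <-> phi a = 0.
Proof.
move=> n2 Aa Fe F'e t0.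
have coorda i : coord (val e) i a = 1 := coord_center e i.
split=> [/projspanP spanA|phia].
  have [U UP] := scalar_kernel phi.
  apply/UP/(projsubE _ Aa)/spanA => B /desargues_pointsP[i [j [ij [Bij B'ij]]]].
  have Bb := homvec_repr B; apply/(projsubE _ Bb)/UP.
  have /(lineP (Fe i) (Fe j) Bb)[x [y bE]] := Bij.
  have /(lineP (F'e i) (F'e j) Bb)[x' [y' bE']] := B'ij.
  set b := val (repr B) in bE bE' *.
  have [k [ki kj]] := exists_third i j n2.
  have ji : (j == i) = false by rewrite -val_eqE gtn_eqF.
  have bcoord l : coord (val e) l b = x * (i == l)%:R + y * (j == l)%:R.
    by rewrite bE linearD !linearZ /= !chart_coordE.
  have bcoord' l : coord (val e) l b =
      x' * ((i == l)%:R + phi (tnth (val e) i)) +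
      y' * ((j == l)%:R + phi (tnth (val e) j)).
    rewrite bE' linearD !linearZ /= !form_collin /= !chart_coordE coorda.
    by rewrite !mulr1.
  have := bcoord' k; rewrite bcoord !(eq_sym _ k) (negPf ki) (negPf kj).
  rewrite !mulr0 !add0r => bk.
  have xx' : x = x'.
    have := bcoord' i; rewrite bcoord eqxx ji mulr0 addr0 !mulr1 add0r.
    by rewrite mulrDr mulr1 -addrA -bk addr0.
  have yy' : y = y'.
    have := bcoord' j; rewrite bcoord eqxx eq_sym ji mulr0 add0r !mulr1 add0r.
    by rewrite mulrDr mulr1 addrCA -bk addr0.
  by rewrite bE linearD !linearZ /= xx' yy' -bk.
apply/projspanP => U desU; apply/(projsubE _ Aa).
pose u j := phi (tnth (val e) j) *: tnth (val e) ord0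
            + (- phi (tnth (val e) ord0)) *: tnth (val e) j.
have uU j : u j \in U.
  have [->|j0] := eqVneq j ord0; first by rewrite /u scaleNr subrr mem0v.
  have coordu : coord (val e) ord0 (u j) != 0.
    rewrite linearD !linearZ /= !chart_coordE eqxx (negPf j0).
    by rewrite mulr1 mulr0 addr0.
  have u0 : u j != 0.
    by apply: contra_neq coordu => ->; rewrite linear0.
  have [B Bu] := homvec_exists u0.
  apply/(projsubE _ Bu)/desU/desargues_pointsP.
  exists ord0, j; split; first by rewrite lt0n.
  split.
    apply/(lineP (Fe _) (Fe _) Bu).
    by exists (phi (tnth (val e) j)), (- phi (tnth (val e) ord0)).
  apply/(lineP (F'e _) (F'e _) Bu).
  exists (phi (tnth (val e) j)), (- phi (tnth (val e) ord0)).
  rewrite /collin !scalerDr addrACA !scalerA -scalerDl mulrC mulNr subrr scale0r.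
  by rewrite addr0.
have /(memvZ (- phi (tnth (val e) ord0))^-1) : \sum_j u j \in U.
  by apply: memv_suml => j _.
rewrite big_split /= -scaler_suml -linear_sum -/a phia scale0r add0r.
by rewrite -scaler_sumr scalerK // oppr_eq0.
Qed.

(** Suppose that h maps F to F' and is induced by f. Then f maps each e_i to a
    multiple l_i of its image under the collineation, and a to a multiple of a;
    comparing the coordinates of f(a), all the l_i are equal. So h is the
    central collineation, and its differential decides. *)
Lemma frame_equiv_elation A F F' e (phi : {scalar V})
    (a := \sum_i tnth (val e) i) : (2 <= n)%N -> homvec A a ->
  F ord0 = A -> F' ord0 = A ->
  (forall i, homvec (F (lift ord0 i)) (tnth (val e) i)) ->
  (forall i, homvec (F' (lift ord0 i)) (collin phi a (tnth (val e) i))) ->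
  1 + phi a != 0 ->
  frame_equiv A F F' <-> phi a = 0.
Proof.
move=> n2 Aa F0 F'0 Fe F'e phia0.
have coorda i : coord (val e) i a = 1 := coord_center e i.
split=> [[h [[[f fbij hf] hA] dh] F'h]|phia].
  have hF j x : homvec (F j) x -> homvec (F' j) (f x).
    by rewrite F'h; exact: projective_transformation_homvec.
  have Afa : homvec A (f a) by rewrite -F'0; apply: hF; rewrite F0.
  have [l0 _ fa] := homvec_inj Aa Afa.
  have /choice[l lP] i : exists k, k != 0 /\
      f (tnth (val e) i) = k *: collin phi a (tnth (val e) i).
    by have [k k0 fE] := homvec_inj (F'e i) (hF _ _ (Fe i)); exists k.
  (* Comparison of the i-th coordinates of f(a) = l0 a. *)
  pose L := l0 - \sum_i l i * phi (tnth (val e) i).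
  have lE i : l i = L.
    have : coord (val e) i (f a) = l0 by rewrite fa linearZ /= coorda mulr1.
    rewrite {1}/a linear_sum.
    under eq_bigr do rewrite (lP _).2 /collin scalerDr scalerA.
    rewrite big_split -scaler_suml linearD linearZ /= coorda mulr1 chart_coord.
    by move=> sE; rewrite /L -sE addrK.
  have fE x : f x = L *: collin phi a x.
    rewrite [x](chart_sum e) !linear_sum; apply: eq_bigr => i _.
    by rewrite !linearZ /= (lP i).2 lE !scalerA mulrC.
  have L0 : L != 0 by rewrite -(lE ord0) (lP ord0).1.
  have hhom p x : homvec p x -> homvec (h p) (collin phi a x).
    move=> /(projective_transformation_homvec fbij hf); rewrite fE.
    by move=> /(homvec_scale (invr_neq0 L0)); rewrite scalerK.
  have eA : chart_dom e A.
    by apply/(chart_dom_homvec e Aa); rewrite coorda oner_neq0.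
  have := dh e eA; rewrite (differential_collin Aa eA phia0 hhom).
  move=> /(congr1 (fun d => d (const_mx 1)))/rowP/(_ (Ordinal n2)).
  rewrite !mxE mulr1 => /(congr1 GRing.inv); rewrite invrK invr1.
  by move=> /eqP; rewrite -subr_eq0 addrAC subrr add0r => /eqP.
have [g gT ghom] := projective_transformation_exists (elation_bij phia).
exists g.
  split.
    split=> //; apply: homvec_point_inj (ghom _ _ Aa) _.
    by rewrite /= collin_center phia addr0 scale1r.
  move=> c cA; rewrite (differential_collin Aa cA phia0 ghom) phia addr0 invr1.
  by apply/funext => v; rewrite scale1r.
apply/funext => j /=; case: (unliftP ord0 j) => [i ->|->].
  exact: homvec_point_inj (F'e i) (ghom _ _ (Fe i)).
rewrite F'0 F0; apply: homvec_point_inj (Aa) _.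
by have := ghom _ _ Aa; rewrite /= collin_center phia addr0 scale1r.
Qed.

End StrictPerspective.

Theorem theorem4 (R : realType) (n : nat) (V : vectType R)
    (A : projspace V) (F F' : 'I_n.+2 -> projspace V) :
  (2 <= n)%N -> \dim {: V} = n.+1 ->
  adapted_frame A F -> adapted_frame A F' -> in_strict_perspective F F' ->
  frame_equiv A F F' <-> desargues_hyperplane F F' A.
Proof.
move=> n2 dimV frF frF' FF'.
have [e [phi /= [Aa Fe F'e t0 phia]]] :=
  strict_perspective_collin dimV n2 frF frF' FF'.
have [F0 F'0] := (frame_center frF, frame_center frF').
rewrite (frame_equiv_elation n2 Aa F0 F'0 Fe F'e phia).
by rewrite (desargues_hyperplane_axis n2 Aa Fe F'e t0).
Qed.
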